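(* In the abelian Polish group $\mathbb{Z}^\omega$ there exists a $G_\delta$ set $R$ that is Haar meager but not strongly Haar meager.
   Context: $\mathbb{Z}^\omega$ is the group of all integer sequences under coordinatewise addition, with the product topology of countably many copies of the discrete group $\mathbb{Z}$. For an abelian Polish group $(G,+)$: a set $A\subseteq G$ is \emph{Haar meager} if there are a Borel set $B\supseteq A$, a nonempty compact metric space $K$ and a continuous function $f:K\to G$ such that $f^{-1}(B+g)$ is meager in $K$ for every $g\in G$. A set $A\subseteq G$ is \emph{strongly Haar meager} if there are a Borel set $B\supseteq A$ and a nonempty compact set $C\subseteq G$ such that $(B+g)\cap C$ is meager in $C$ for every $g\in G$. *)

(* Defs.v *)
From HB Require Import structures.
From mathcomp Require Import all_boot all_order all_algebra.
From mathcomp Require Import all_classical all_reals all_analysis.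

Set Implicit Arguments.
Unset Strict Implicit.
Unset Printing Implicit Defensive.

Import Order.TTheory GRing.Theory Num.Theory.

Local Open Scope classical_set_scope.
Local Open Scope ring_scope.

Section Meager.
Context {T : topologicalType}.
Implicit Types A : set T.

Definition nowhere_dense A := interior (closure A) = set0.

Definition meager A :=
  exists2 F : (set T)^nat,
    (forall n, nowhere_dense (F n)) & A `<=` \bigcup_n F n.

Definition borel_set A := <<s @open T >> A.

End Meager.

(* [C] is coerced to the subtype of its elements, which carries the subspace
   topology; [subspace C] would instead keep the points outside [C]. *)
Definition meager_in (T : topologicalType) (C A : set T) :=
  meager ((@set_val T C) @^-1` A).

Definition translate (G : zmodType) (B : set G) (g : G) : set G :=
  [set b + g | b in B].

(* [R] is the field of real numbers in which the metric of [K] takes values. *)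
Definition haar_meager (R : realType) (G : topologicalZmodType) (A : set G) :=
  exists2 B : set G, borel_set B /\ A `<=` B &
  exists (K : metricType R) (f : K -> G),
    [/\ [set: K] !=set0, compact [set: K], continuous f &
        forall g : G, meager (f @^-1` translate B g)].

Definition strongly_haar_meager (G : topologicalZmodType) (A : set G) :=
  exists2 B : set G, borel_set B /\ A `<=` B &
  exists C : set G,
    [/\ C !=set0, compact C &
        forall g : G, meager_in C (translate B g `&` C)].

Definition Zomega : Type := nat -> int.

HB.instance Definition _ := GRing.Zmodule.copy Zomega (nat -> int).
HB.instance Definition _ :=
  Topological.copy Zomega (prod_topology (fun _ : nat => discrete_topology int)).

Lemma Zomega_sub_continuous : continuous (fun x : Zomega * Zomega => x.1 - x.2).
Proof.
move=> [x y]; apply/cvg_sup => n; apply/cvg_image.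
  rewrite eqEsubset; split => z // _; by exists (fun=> z).
move=> A /= /principal_filterP Axy.
have nbhs_coord (z : Zomega) : nbhs z [set u : Zomega | u n = z n].
  have /= := @proj_continuous nat (fun=> discrete_topology int) n z [set z n].
  by apply; exact: discrete_set1.
exists [set u : Zomega | A (u n)]; last first.
  by rewrite eqEsubset; split=> [_ [u Au <-]//|z Az]; exists (fun=> z).
exists ([set u : Zomega | u n = x n], [set u : Zomega | u n = y n]) => /=.
  by split; exact: nbhs_coord.
by move=> [u v] /= [un vn]; rewrite /GRing.add/= /GRing.opp/= un vn.
Qed.

HB.instance Definition _ :=
  PreTopologicalNmodule_isTopologicalZmodule.Build Zomega Zomega_sub_continuous.

(* Main.v *)
Require Import Defs.
From HB Require Import structures.
From mathcomp Require Import all_boot all_order all_algebra.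
From mathcomp Require Import all_classical all_reals all_analysis.
From mathcomp Require Import borel_hierarchy.
From mathcomp Require Import zify.

(* The test map f : 2^omega -> Z^omega is f(x)(n) = #{i <= n : e_i(n) = 1 and
   d_i = 0}, where the bits d_i and e_i(n) of x are independent. Inside any
   cylinder s pick a fresh i and let t be the subcylinder d_i = 1. For x in t
   and n >= i, switching d_i off and taking e_i to be the indicator of {n}
   gives y in s such that f(y) agrees with f(x) below n and
   f(y)(n) = f(x)(n) + 1.

   For compact C let Q(C) be the set of x in C such that, for infinitely many n,
   no element of C agrees with x below n and takes the value x(n) + 1 at n.
   Choosing the largest possible coordinate over and over shows that Q(C) is
   comeager in C. On the other hand, f^-1(Q(C) + g) is nowhere dense for every
   g: if it is dense in a cylinder s, then f(s) - g lies in C because C is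
   closed, and then f(t) - g misses Q(C) by the choice of t.

   The set R is the union over all compact C of the translates Q(C) + h(C),
   where h(C)(n) encodes the finite set of prefixes of length n + 1 of elements
   of C. The values of h are so sparse that C is recovered coordinatewise, hence
   R is G_delta, and so that each translate of the range of f, which lies in
   the product of the intervals [0, n + 1], meets a single Q(C) + h(C). *)

Set Implicit Arguments.
Unset Strict Implicit.
Unset Printing Implicit Defensive.

Import Order.TTheory GRing.Theory Num.Theory.

Local Open Scope classical_set_scope.
Local Open Scope ring_scope.

(** * Cylinders and compactness in sequence spaces *)

Definition agree (T : Type) n (x y : nat -> T) :=
  forall k, (k < n)%N -> x k = y k.

Lemma agree_sym T n (x y : nat -> T) : agree n x y -> agree n y x.
Proof. by move=> xy k /xy. Qed.

Lemma agree_trans T n (x y z : nat -> T) :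
  agree n x y -> agree n y z -> agree n x z.
Proof. by move=> xy yz k kn; rewrite xy// yz. Qed.

Lemma agreeW T m n (x y : nat -> T) : (m <= n)%N -> agree n x y -> agree m x y.
Proof. by move=> mn xy k km; apply: xy; exact: leq_trans mn. Qed.

Lemma nbhs_agree (T : topologicalType)
    (x : prod_topology (fun _ : nat => T)) n :
  (forall y : T, nbhs y [set y]) -> nbhs x (agree n x).
Proof.
move=> nT; have Fx : Filter (nbhs x) := nbhs_filter x.
elim: n => [|n IH]; first by apply: filterE => y k.
have nx : nbhs x [set y : prod_topology (fun _ : nat => T) | y n = x n].
  exact: (@proj_continuous nat (fun=> T) n x [set x n]) (nT (x n)).
apply: filterS (filterI IH nx) => y [xy /= xyn] k.
by rewrite ltnS leq_eqVlt => /predU1P[->//|]; exact: xy.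
Qed.

Lemma nbhs_Zomega (z : Zomega) (A : set Zomega) :
  nbhs z A <-> exists n, agree n z `<=` A.
Proof.
split; last first.
  move=> [n zA]; apply: filterS zA _.
  exact: (@nbhs_agree (discrete_topology int)) (@discrete_set1 _).
pose F := filter_from [set: nat] (fun n => agree n z : set Zomega).
have FF : Filter F.
  apply: filter_from_filter; first by exists 0%N.
  move=> m n _ _; exists (maxn m n) => // u zu; split;
    by apply: agreeW zu; rewrite ?leq_maxl ?leq_maxr.
(* The product topology is a supremum, so convergence of the cylinder filter can be tested one
   coordinate at a time. *)
suff Fz : F --> z by move=> /Fz[n _ ?]; exists n.
apply/cvg_sup => n; apply/cvg_image.
  rewrite eqEsubset; split => u // _; by exists (fun=> u).
move=> A' /= /principal_filterP Azn.
exists [set u : Zomega | A' (u n)].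
  by exists n.+1 => // u zu /=; rewrite -zu.
by rewrite eqEsubset; split=> [_ [u Au <-]//|u Au]; exists (fun=> u).
Qed.

Lemma Zomega_hausdorff : hausdorff_space Zomega.
Proof.
apply: (@hausdorff_product nat (fun=> discrete_topology int)) => _.
exact: discrete_hausdorff.
Qed.

Lemma open_agree (z : Zomega) n : open (agree n z : set Zomega).
Proof.
rewrite openE => u zu; apply/nbhs_Zomega; exists n => v uv.
exact: agree_trans zu uv.
Qed.

Definition prefix_of (n : nat) (z : Zomega) : seq int := mkseq z n.

Lemma prefix_ofP n (x y : Zomega) :
  prefix_of n x = prefix_of n y <-> agree n x y.
Proof.
split=> [xy k kn|xy].
  by have := congr1 (fun s => s`_k) xy; rewrite !nth_mkseq.
by apply/eq_in_map => k; rewrite mem_iota => /andP[_]; exact: xy.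
Qed.

HB.instance Definition _ := isPointed.Build Zomega 0.

Lemma compact_prefixes (C : set Zomega) n : compact C ->
  exists T : seq (seq int),
    forall s, s \in T <-> exists2 x, C x & s = prefix_of n x.
Proof.
rewrite compact_cover => cC.
have [|x Cx|D DC CD] := cC Zomega C (fun z => agree n z).
- by move=> z _; exact: open_agree.
- by exists x.
exists [seq prefix_of n z | z <- finmap.enum_fset D] => s; split.
  by move=> /mapP[x xD ->]; exists x => //; have /set_mem := DC _ xD.
move=> [x Cx ->]; have [y yD /prefix_ofP <-] := CD x Cx.
exact: map_f.
Qed.

Lemma closed_agree (C : set Zomega) x : closed C ->
  (forall n, exists2 y, C y & agree n x y) -> C x.
Proof.
move=> /closure_id clC xC; rewrite clC => A /nbhs_Zomega[n nA].
by have [y Cy xy] := xC n; exists y; split=> //; exact: nA.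
Qed.

(** * The Cantor space as a compact metric space *)

Definition cantor_metric (R : realType) : Type := nat -> bool.

HB.instance Definition _ (R : realType) :=
  Choice.copy (cantor_metric R) (nat -> bool).

Section CantorMetric.
Variable R : realType.
Implicit Types x y z : cantor_metric R.

Definition cantor_dist x y : R :=
  if pselect (exists n, x n != y n) is left xy then (ex_minn xy).+1%:R^-1
  else 0.

Lemma cantor_dist_ge x y n : x n != y n -> n.+1%:R^-1 <= cantor_dist x y.
Proof.
rewrite /cantor_dist => xyn; case: pselect => [xy|[]]; last by exists n.
case: ex_minnP => m _ /(_ n xyn) mn.
by rewrite lef_pV2 ?posrE ?ltr0Sn// ler_nat.
Qed.

Lemma cantor_dist_le x y n : agree n x y -> cantor_dist x y <= n.+1%:R^-1.
Proof.
rewrite /cantor_dist => xy; case: pselect => [xy'|_]; last first.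
  by rewrite invr_ge0 ler0n.
case: ex_minnP => m xym _; rewrite lef_pV2 ?posrE ?ltr0Sn// ler_nat ltnS leqNgt.
by apply: contra xym => /xy ->.
Qed.

Lemma cantor_distxx x : cantor_dist x x = 0.
Proof.
by rewrite /cantor_dist; case: pselect => // xx; exfalso; case: xx => n /eqP.
Qed.

Lemma cantor_dist0 x y : cantor_dist x y = 0 -> x = y.
Proof.
move=> xy; apply/funext => n; apply/eqP/negPn/negP => /cantor_dist_ge.
by rewrite xy invr_le0 lern0.
Qed.

Lemma cantor_distC x y : cantor_dist x y = cantor_dist y x.
Proof.
suff le u v : cantor_dist u v <= cantor_dist v u.
  by apply/eqP; rewrite eq_le !le.
rewrite {1}/cantor_dist; case: pselect => [uv|uv].
  by case: ex_minnP => m + _; rewrite eq_sym; exact: cantor_dist_ge.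
by rewrite /cantor_dist; case: pselect => // ?; rewrite invr_ge0 ler0n.
Qed.

Lemma cantor_dist_ge0 x y : 0 <= cantor_dist x y.
Proof.
by rewrite /cantor_dist; case: pselect => // ?; rewrite invr_ge0 ler0n.
Qed.

Lemma cantor_dist_triangle y x z :
  cantor_dist x z <= cantor_dist x y + cantor_dist y z.
Proof.
rewrite {1}/cantor_dist; case: pselect => [xz|_]; last first.
  by rewrite addr_ge0 ?cantor_dist_ge0.
(* Where [x] and [z] first differ, [y] differs from one of them. *)
case: ex_minnP => m xzm _; have [xym|xym] := eqVneq (x m) (y m).
  by rewrite ler_wpDl ?cantor_dist_ge0// cantor_dist_ge// -xym.
by rewrite ler_wpDr ?cantor_dist_ge0// cantor_dist_ge.
Qed.

HB.instance Definition _ := isMetric.Build R (cantor_metric R)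
  cantor_distxx cantor_dist0 cantor_distC cantor_dist_triangle.

Lemma nbhs_cantor x (A : set (cantor_metric R)) :
  nbhs x A <-> exists n, agree n x `<=` A.
Proof.
rewrite -nbhs_ballE; split=> [[e /= e0 eA]|[n nA]].
  have [n] := ltr_add_invr e0; rewrite add0r => ne.
  exists n => y xy; apply: eA; rewrite ballEmdist.
  by apply: le_lt_trans ne; exact: cantor_dist_le.
exists n.+1%:R^-1 => /=; first by rewrite invr_gt0 ltr0Sn.
rewrite ballEmdist => y /= xy; apply: nA => k kn; apply/eqP/negPn/negP.
move=> /cantor_dist_ge; apply/negP; rewrite -ltNge; apply: lt_le_trans xy _.
by rewrite lef_pV2 ?posrE ?ltr0Sn// ler_nat ltnS ltnW.
Qed.

Lemma cantor_metric_compact : compact [set: cantor_metric R].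
Proof.
have idc : continuous (id : cantor_space -> cantor_metric R).
  move=> x A /nbhs_cantor[n nA]; apply: filterS nA _.
  exact: nbhs_agree (@discrete_set1 _).
have -> : [set: cantor_metric R] = (id : cantor_space -> _) @` setT.
  by rewrite eqEsubset; split=> // x _; exists x.
apply: continuous_compact; last exact: cantor_space_compact.
exact: continuous_subspaceT.
Qed.

End CantorMetric.

(** * The test map *)

Definition bit (x : nat -> bool) (i k : nat) : bool := x (pickle (i, k)).

(* In the notation of the header, [d_i = bit x i 0] and
   [e_i(n) = bit x i (n + 1)]. *)
Definition test_point (x : nat -> bool) : Zomega :=
  fun n => (\sum_(i < n.+1) (bit x i n.+1 && ~~ bit x i 0))%N%:Z.

Lemma test_point_bound x n : 0 <= test_point x n <= n.+1%:Z.
Proof.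
rewrite /test_point lez_nat /= -[leqRHS]card_ord -sum1_card.
by apply: leq_sum => i _; exact: leq_b1.
Qed.

Lemma test_point_modulus n : exists m, forall x y : nat -> bool,
  agree m x y -> agree n (test_point x) (test_point y).
Proof.
elim: n => [|n [m mP]]; first by exists 0%N.
pose w (i : nat) := maxn (pickle (i, n.+1)) (pickle (i, 0%N)).
exists (maxn m (\max_(i < n.+1) w i).+1).
move=> x y xy k; rewrite ltnS leq_eqVlt => /predU1P[->|]; last first.
  by apply: mP; apply: agreeW xy; exact: leq_maxl.
congr (Posz _); apply: eq_bigr => i _.
have le j : (j <= w i)%N -> x j = y j.
  move=> ji; apply: xy; rewrite leq_max; apply/orP; right; rewrite ltnS.
  apply: leq_trans ji _.
  exact: (leq_bigmax_cond (F := fun i : 'I_n.+1 => w i)).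
by rewrite /bit !le ?leq_maxl ?leq_maxr.
Qed.

(** Only finitely many pairs have a code below [m]; a row index above all of theirs will do. *)
Lemma pickle_gt m : exists i : nat, forall k : nat, (m <= pickle (i, k))%N.
Proof.
exists (\max_(j < m) (odflt (0, 0)%N (unpickle j)).1).+1 => k; rewrite leqNgt.
set i := (X in (X, k)); apply/negP => lt_m.
have := leq_bigmax (F := fun j : 'I_m => (odflt (0, 0)%N (unpickle j)).1)
  (Ordinal lt_m).
by rewrite /= pickleK /= ltnn.
Qed.

Lemma test_point_bump m : exists2 i : nat, (m <= pickle (i, 0%N))%N &
  forall x : nat -> bool, bit x i 0%N -> forall n, (i <= n)%N ->
  exists y : nat -> bool,
    [/\ agree m x y, agree n (test_point x) (test_point y) &
        test_point y n = test_point x n + 1].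
Proof.
have [i im] := pickle_gt m; exists i => // x xi n le_in.
(* Row [i] becomes the indicator of column [n.+1]: column 0 is cleared, so d_i is off, and e_i is on
   exactly at [n]. *)
pose y j := if pickle_inv j is Some (i', k) then
  if i' == i then (k == n.+1) else x j else x j.
have yE i' k : bit y i' k = if i' == i then k == n.+1 else bit x i' k.
  by rewrite /bit /y pickleK_inv.
have xyE k : (test_point y k = test_point x k + (k == n)%:R).
  rewrite /test_point; have [ik|ki] := ltnP i k.+1.
    rewrite (bigD1 (Ordinal ik))//= [in RHS](bigD1 (Ordinal ik))//=.
    rewrite !yE !eqxx xi andbF add0n eqSS andbT.
    rewrite PoszD addrC; congr (_ + _); last by case: eqP.
    congr Posz; apply: eq_bigr => j ji.
    have ji' : (j == i :> nat) = false := negPf ji.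
    by rewrite !yE ji'.
  rewrite (_ : k == n = false) ?addr0; last first.
    by apply/eqP => kn; rewrite kn ltnNge le_in in ki.
  congr Posz; apply: eq_bigr => j _; rewrite !yE ltn_eqF//.
  exact: leq_trans (ltn_ord j) ki.
exists y; split; last by rewrite xyE eqxx.
  move=> j jm; rewrite /y; have := pickle_invK (T := (nat * nat)%type) j.
  case: pickle_inv => [[i' k]|//] /= jE; case: eqP => // ii'.
  by have := im k; rewrite -ii' jE leqNgt jm.
by move=> k kn; rewrite xyE ltn_eqF// addr0.
Qed.

Lemma Zomega_subE (x y : Zomega) n : (x - y) n = x n - y n.
Proof. by []. Qed.

(** * Coding finite sets of prefixes by sparse integers *)

Definition coded_tree (N : nat) : seq (seq int) := odflt [::] (unpickle N).

(** A crude bound for the last entry of every listed prefix. *)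
Definition code_bound (N : nat) : nat :=
  (\sum_(s <- coded_tree N) `|last 0%R s|)%N.

(* Consecutive values are so far apart that [N] can be read off from
   [a + code_shift n N], [`|a| <= code_bound N], even up to an error [n + 1]. *)
Definition code_shift (n N : nat) : nat :=
  (code_bound N + \sum_(i < N) (2 * code_bound i + n.+2))%N.

(** The summand of index [N] in [code_shift n M] pays for both copies of [code_bound N] and for the
    error. *)
Lemma code_shift_lt n N M : (N < M)%N ->
  (code_shift n N + code_bound N + code_bound M + n.+1 < code_shift n M)%N.
Proof.
move=> NM; rewrite /code_shift.
have : (\sum_(i < N.+1) (2 * code_bound i + n.+2) <=
        \sum_(i < M) (2 * code_bound i + n.+2))%N.
  rewrite -!(big_mkord xpredT (fun i => 2 * code_bound i + n.+2)%N).
  by rewrite [leqRHS](big_cat_nat _ NM)//= leq_addr.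
by rewrite big_ord_recr /=; lia.
Qed.

Lemma code_shift_inj n N M (a b : int) :
  (`|a| <= code_bound N)%N -> (`|b| <= code_bound M)%N ->
  (`|((a + (code_shift n N)%:Z) - (b + (code_shift n M)%:Z))%R| <= n.+1)%N ->
  N = M.
Proof.
move=> aN bM ab; have [NM|MN|//] := ltngtP N M.
- by have := code_shift_lt n NM; lia.
- by have := code_shift_lt n MN; lia.
Qed.

(** The value 0 is a default off all windows; on a window, [code_shift_inj] makes [N] unique. *)
Definition decode (n : nat) (a : int) : nat :=
  xget 0%N [set N | (`|(a - (code_shift n N)%:Z)%R| <= code_bound N)%N].

Lemma decode_shift n N (a : int) : (`|a| <= code_bound N)%N ->
  decode n (a + (code_shift n N)%:Z) = N.
Proof.
move=> aN; rewrite /decode; case: xgetP => [M _ /= MN|/(_ N)/=]; last first.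
  by rewrite addrK.
by apply: (@code_shift_inj n _ _ _ _ MN aN); rewrite subrK subrr.
Qed.

Lemma last_code_bound N s :
  s \in coded_tree N -> (`|last 0%R s| <= code_bound N)%N.
Proof. by move=> sN; rewrite /code_bound (big_rem s)//= leq_addr. Qed.

(** This is h(C) when [c n] codes the prefixes of length [n.+1] of elements of C. *)
Definition shift_by (c : nat -> nat) : Zomega :=
  fun n => (code_shift n (c n))%:Z.

Definition codes (z : Zomega) : nat -> nat := fun n => decode n (z n).

Definition decoded (z : Zomega) : Zomega := z - shift_by (codes z).

(** * The set R and its Borel class *)

Definition in_tree (c : nat -> nat) (x : Zomega) n :=
  prefix_of n.+1 x \in coded_tree (c n).

Definition skips (c : nat -> nat) (x : Zomega) n :=
  rcons (prefix_of n x) (x n + 1) \notin coded_tree (c n).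

(** Decoding [z] coordinatewise replaces a union over compact sets, so that each condition is
    witnessed by finitely many coordinates. By [skipping_setD], every Q(C) + h(C) is included. *)
Definition skipping_set : set Zomega :=
  [set z | forall m, in_tree (codes z) (decoded z) m /\
                     exists2 n, (m <= n)%N & skips (codes z) (decoded z) n].

Lemma last_prefix n (x : Zomega) : last 0 (prefix_of n.+1 x) = x n.
Proof. by rewrite /prefix_of mkseqS last_rcons. Qed.

Lemma in_tree_bound c x n : in_tree c x n -> (`|x n| <= code_bound (c n))%N.
Proof. by move/last_code_bound; rewrite last_prefix. Qed.

Lemma code_addl c x : (forall n, in_tree c x n) -> codes (x + shift_by c) = c.
Proof. by move=> xc; apply/funext => n; apply/decode_shift/in_tree_bound. Qed.

Lemma skipping_setD c x : (forall n, in_tree c x n) ->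
  (forall m, exists2 n, (m <= n)%N & skips c x n) ->
  skipping_set (x + shift_by c).
Proof.
by move=> xc xs m; rewrite /decoded code_addl// addrK; split.
Qed.

Lemma skipping_set_code (z u : Zomega) : skipping_set z -> skipping_set u ->
  (forall n, (`|(z n - u n)%R| <= n.+1)%N) -> codes z = codes u.
Proof.
move=> Rz Ru zu; apply/funext => n.
have [/in_tree_bound zb _] := Rz n; have [/in_tree_bound ub _] := Ru n.
apply: (code_shift_inj (n := n) zb ub).
by rewrite /decoded /shift_by /= !subrK.
Qed.

Lemma open_cylinders (P : set Zomega) :
  (forall z, P z -> exists n, agree n z `<=` P) -> open P.
Proof. by move=> PP; rewrite openE => z /PP /nbhs_Zomega. Qed.

Lemma code_agree n z u : agree n z u -> agree n (codes z) (codes u).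
Proof. by move=> zu k kn; rewrite /codes zu. Qed.

Lemma decoded_agree n z u : agree n z u -> agree n (decoded z) (decoded u).
Proof.
by move=> zu k kn; rewrite /decoded !Zomega_subE /shift_by /codes zu.
Qed.

Lemma skipping_set_Gdelta : Gdelta skipping_set.
Proof.
exists (fun m => [set z | in_tree (codes z) (decoded z) m /\
  exists2 n, (m <= n)%N & skips (codes z) (decoded z) n]); last first.
  by rewrite eqEsubset; split=> [z Rz m _|z Rz m]; exact: Rz.
move=> m; apply: open_cylinders => z [zm [n mn zn]].
(* As [m <= n], the first [n.+1] coordinates decide both [in_tree] at [m] and [skips] at [n]. *)
exists n.+1 => u zu; have zc := code_agree zu; have zd := decoded_agree zu.
have pre k : (k <= n.+1)%N -> prefix_of k (decoded z) = prefix_of k (decoded u).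
  by move=> kn; apply/prefix_ofP; exact: agreeW zd.
split; first by rewrite /in_tree -zc// -pre.
by exists n => //; rewrite /skips -zc// -zd// -pre.
Qed.

Lemma Gdelta_borel (T : topologicalType) (A : set T) : Gdelta A -> borel_set A.
Proof.
move=> [F oF ->].
rewrite -[\bigcap_i _]setCK setC_bigcap -setTD; apply: sigma_algebraCD.
apply: sigma_algebra_bigcup => n; rewrite -setTD; apply: sigma_algebraCD.
exact: sub_sigma_algebra.
Qed.

(** * Nowhere dense preimages under the test map *)

Lemma translateE (G : zmodType) (B : set G) g z : translate B g z <-> B (z - g).
Proof.
split=> [[b Bb <-]|Bz]; first by rewrite addrK.
by exists (z - g); rewrite ?subrK.
Qed.

Lemma nowhere_dense_meager (T : topologicalType) (A : set T) :
  nowhere_dense A -> meager A.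
Proof. by move=> nA; exists (fun=> A) => // x Ax; exists 0%N. Qed.

Lemma continuous_test_point (R : realType) :
  continuous (test_point : cantor_metric R -> Zomega).
Proof.
move=> x A /nbhs_Zomega[n nA]; have [m mP] := test_point_modulus n.
by apply/nbhs_cantor; exists m => y xy; apply: nA; exact: mP.
Qed.

Lemma test_point_preimage_nowhere_dense (R : realType) (g : Zomega) :
  nowhere_dense ((test_point : cantor_metric R -> Zomega) @^-1`
                 translate skipping_set g).
Proof.
apply/seteqP; split=> // x /nbhs_cantor[m xm].
have dense y n : agree m x y ->
    exists2 y', agree n y y' & skipping_set (test_point y' - g).
  move=> /xm /(_ (agree n (y : cantor_metric R)))[].
    by apply/nbhs_cantor; exists n.
  by move=> y' [/translateE Ry' yy']; exists y'.
have [y0 _ Ry0] := dense x 0%N (fun _ _ => erefl).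
set c := codes (test_point y0 - g).
(* Two values of the test map differ by at most [n.+1] at [n], too little to change the code. *)
have code_c y : skipping_set (test_point y - g) -> codes (test_point y - g) = c.
  move=> Ry; apply: skipping_set_code => // n.
  have /andP[] := test_point_bound y n; have /andP[] := test_point_bound y0 n.
  by rewrite !Zomega_subE; lia.
pose x_ y : Zomega := test_point y - g - shift_by c.
have agree_x_ n y y' :
    agree n (test_point y) (test_point y') -> agree n (x_ y) (x_ y').
  by move=> yy' k kn; rewrite /x_ !Zomega_subE yy'.
(* Membership at [n] depends on finitely many bits of [y], so it passes from the dense preimage to
   the whole cylinder. *)
have in_c y n : agree m x y -> in_tree c (x_ y) n.
  move=> xy; have [N NP] := test_point_modulus n.+1.
  have [y' /NP yy' Ry'] := dense y N xy; have [+ _] := Ry' n.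
  rewrite /decoded code_c// -/(x_ y') /in_tree.
  by rewrite (_ : prefix_of n.+1 (x_ y') = prefix_of n.+1 (x_ y))//;
    apply/prefix_ofP/agree_x_/agree_sym.
have [i im bump] := test_point_bump m.
pose y1 j := if j == pickle (i, 0%N) then true else x j.
have xy1 : agree m x y1.
  by move=> k km; rewrite /y1 ltn_eqF//; exact: leq_trans im.
(* The chosen length makes [y] inherit from [y1] the bit d_i, which is on. *)
have [y y1y Ry] := dense y1 (pickle (i, 0%N)).+1 xy1.
have yi : bit y i 0%N by rewrite /bit -y1y ?ltnSn// /y1 eqxx.
(* At some [n >= i], raising the coordinate by 1 leaves the tree; [bump] realizes this raise inside
   the cylinder, against [in_c]. *)
have [_ [n le_in]] := Ry i; rewrite /decoded code_c// -/(x_ y).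
have [y' [yy' /agree_x_ /prefix_ofP e y'n]] := bump y yi n le_in.
have xy' : agree m x y'.
  apply: agree_trans xy1 (agree_trans _ yy').
  by apply: agreeW y1y; exact: leqW.
have := in_c _ n xy'.
rewrite /in_tree /skips /prefix_of mkseqS -/(prefix_of n _) -e.
have -> : x_ y' n = x_ y n + 1.
  by rewrite /x_ !Zomega_subE y'n; lia.
by move=> ->.
Qed.

(** * Category inside a compact set, and failure of strong Haar meagerness *)

Lemma nbhs_set_type (C : set Zomega) (x : C) (A : set C) :
  nbhs x A <-> exists n, forall u : C, agree n (\val x) (\val u) -> A u.
Proof.
split.
  rewrite nbhsE => -[U [[V oV VU] Ux] UA].
  have /nbhs_Zomega[n nV] : nbhs (\val x : Zomega) V.
    by apply: open_nbhs_nbhs; split=> //; rewrite -VU in Ux.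
  by exists n => u xu; apply: UA; rewrite -VU; exact: nV.
move=> [n nA].
have xn : nbhs (\val x : Zomega) (agree n (\val x) : set Zomega).
  by apply/nbhs_Zomega; exists n.
apply: (@filterS _ _ (nbhs_filter x) _ _ _
  (initial_continuous (f := set_val) xn)).
by move=> u; exact: nA.
Qed.

(** One step of a Baire category argument in [C]: a point outside the closure of [F] supplies the
    subcylinder. *)
Lemma nowhere_dense_avoid (C : set Zomega) (F : set C) z n :
  nowhere_dense F -> C z ->
  exists z' n', [/\ C z', (n <= n')%N, agree n z z' &
    forall u : C, agree n' z' (\val u) -> ~ F u].
Proof.
move=> nF Cz; pose x : C := SigSub (mem_set Cz).
have : ~ nbhs x (closure F).
  by move=> xF; have : set0 x by rewrite -nF.
move=> xF; have [u [xu /existsNP[U /not_implyP[uU FU]]]] :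
    exists u : C, agree n z (\val u) /\ ~ closure F u.
  apply: contrapT => noF; apply: xF; apply/nbhs_set_type; exists n => u xu.
  by apply: contrapT => Fu; apply: noF; exists u.
have [n' n'U] := (nbhs_set_type u U).1 uU.
exists (\val u), (maxn n n'); split => //.
- exact: set_mem (valP u).
- exact: leq_maxl.
- move=> v uv Fv; apply: FU; exists v; split=> //; apply: n'U.
  by apply: agreeW uv; exact: leq_maxr.
Qed.

Lemma maximal_skips (C : set Zomega) (c : nat -> nat) m z :
  (forall s, s \in coded_tree (c m) <->
             exists2 x, C x & s = prefix_of m.+1 x) ->
  C z -> exists z', [/\ C z', agree m z z' & skips c z' m].
Proof.
move=> cC Cz; pose b := code_bound (c m).
have bound x : C x -> (`|x m| <= b)%N.
  by move=> Cx; apply/in_tree_bound/cC; exists x.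
(* The offset [b] turns the values at [m] into naturals at most [b + b], so a largest one exists. *)
pose P k := `[< exists x, [/\ C x, agree m z x & x m = k%:Z - b%:Z] >].
have exP : exists k, P k.
  exists `|(z m + b%:Z)%R|%N; apply/asboolP; exists z; split=> //.
  by have := bound z Cz; lia.
have Pb k : P k -> (k <= b + b)%N.
  by move=> /asboolP[x [Cx _ xm]]; have := bound x Cx; lia.
case: (ex_maxnP exP Pb) => k /asboolP[x [Cx zx xm]] kmax.
exists x; split=> //; apply/negP => /cC[u Cu].
rewrite /prefix_of mkseqS => /rcons_inj[/prefix_ofP xu um].
suff /kmax : P k.+1 by rewrite ltnn.
apply/asboolP; exists u; split=> //; first exact: agree_trans zx xu.
by rewrite -um xm; lia.
Qed.

Lemma nested_agree (p : nat -> Zomega * nat) :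
  (forall n, agree (p n).2 (p n).1 (p n.+1).1) ->
  (forall n, (p n).2 < (p n.+1).2)%N ->
  exists x : Zomega, forall n, agree (p n).2 (p n).1 x.
Proof.
move=> pp p_lt.
have mono n d : agree (p n).2 (p n).1 (p (n + d)%N).1 /\
    ((p n).2 + d <= (p (n + d)%N).2)%N.
  elim: d => [|d [IH1 IH2]]; first by rewrite !addn0.
  rewrite addnS; split; last by have := p_lt (n + d)%N; lia.
  by apply: agree_trans IH1 _; apply: agreeW (pp _); lia.
(* Lengths grow strictly, so the cylinder of index [k.+1] already fixes coordinate [k]. *)
exists (fun k => (p k.+1).1 k) => n k kn.
have [nk|/ltnW kn'] := leqP n k.+1.
  by have [/(_ k kn) + _] := mono n (k.+1 - n)%N; rewrite subnKC.
have [/(_ k)] := mono k.+1 (n - k.+1)%N; rewrite subnKC// => -> //.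
by have [_] := mono 0%N k.+1; rewrite add0n; lia.
Qed.

(** Nested cylinders meeting [C] are built so that each step forces one more skip and avoids the
    next [F n]; their limit lies in Q(C) but in no [F n]. *)
Lemma skipping_set_not_strongly_haar_meager :
  ~ strongly_haar_meager skipping_set.
Proof.
move=> [B [_ RB] [C [[z0 Cz0] cC mC]]].
have [T TP] := choice (fun n => compact_prefixes n.+1 cC).
pose c n := pickle (T n).
have cP n s : s \in coded_tree (c n) <-> exists2 x, C x & s = prefix_of n.+1 x.
  by rewrite /coded_tree pickleK; exact: TP.
have in_c x : C x -> forall n, in_tree c x n by move=> Cx n; apply/cP; exists x.
(* Translating by -h(C) moves the piece Q(C) + h(C) of R back onto Q(C), which the [F n] therefore
   cover. *)
have [F nF FC] := mC (- shift_by c).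
pose step n (p q : Zomega * nat) := C p.1 ->
  [/\ C q.1, agree p.2 p.1 q.1, (p.2 < q.2)%N, skips c q.1 p.2 &
      forall u : C, agree q.2 q.1 (\val u) -> ~ F n u].
have /choice[s sP] :
    forall np : nat * (Zomega * nat), exists q, step np.1 np.2 q.
  move=> [n [z m]] /=.
  (* Off [C] the pair is a dummy value: [step] is vacuous there, which lets [choice] give a total
     function. *)
  have [Cz|nCz] := pselect (C z); last by exists (z, m).
  have [z1 [Cz1 zz1 sz1]] := maximal_skips (cP m) Cz.
  have [z2 [m2 [Cz2 m12 z12 Fz2]]] := nowhere_dense_avoid m.+1 (nF n) Cz1.
  exists (z2, m2) => _ /=; split=> //.
    by apply: agree_trans zz1 _; exact: agreeW z12.
  move: sz1; rewrite /skips -z12// (_ : prefix_of m z1 = prefix_of m z2)//.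
  by apply/prefix_ofP; exact: agreeW z12.
pose p := fix p n := if n is n'.+1 then s (n', p n') else (z0, 0%N).
have Cp n : C (p n).1 by elim: n => //= n /(sP (n, p n))[].
have pP n : step n (p n) (p n.+1) := sP (n, p n).
have [x px] : exists x : Zomega, forall n, agree (p n).2 (p n).1 x.
  by apply: nested_agree => n; have [] := pP n (Cp n).
have p_ge n : (n <= (p n).2)%N.
  elim: n => // n IH; have [_ _ lt _ _] := pP n (Cp n).
  exact: leq_ltn_trans lt.
have Cx : C x.
  apply: closed_agree (compact_closed Zomega_hausdorff cC) _ => n.
  by exists (p n).1 => //; apply: agree_sym; exact: agreeW (px n).
have Rx : skipping_set (x + shift_by c).
  apply: skipping_setD; first exact: in_c.
  move=> n; have [_ _ lt sk _] := pP n (Cp n); exists (p n).2 => //.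
  move: sk; rewrite /skips (px n.+1)//.
  rewrite (_ : prefix_of _ (p n.+1).1 = prefix_of (p n).2 x)//.
  by apply/prefix_ofP; apply: agreeW (px n.+1); exact: ltnW.
have [n _ Fx] : (\bigcup_n F n) (SigSub (mem_set Cx) : C).
  by apply: FC; split=> //; apply/translateE; rewrite opprK; exact: RB.
have [_ _ _ _ /(_ (SigSub (mem_set Cx)))] := pP n (Cp n).
by apply=> //; exact: px.
Qed.

Theorem theorem1p9 (R : realType) :
  exists A : set Zomega,
    [/\ Gdelta A, haar_meager R A & ~ strongly_haar_meager A].
Proof.
exists skipping_set; split.
- exact: skipping_set_Gdelta.
- exists skipping_set.
    by split=> //; apply: Gdelta_borel; exact: skipping_set_Gdelta.
  exists (cantor_metric R), test_point; split.
  + by exists (fun=> false).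
  + exact: cantor_metric_compact.
  + exact: continuous_test_point.
  + move=> g; apply: nowhere_dense_meager.
    exact: test_point_preimage_nowhere_dense.
- exact: skipping_set_not_strongly_haar_meager.
Qed.
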